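(* Let $\varphi:[0,1]\to\mathbb{R}^2$ be an $L$-biLipschitz function, and let $\varepsilon>0$. Then there exists an $(L+\varepsilon)$-biLipschitz function $\varphi_\varepsilon:[0,1]\to\mathbb{R}^2$ such that $$\varphi_\varepsilon(0)=\varphi(0),\qquad \varphi_\varepsilon(1)=\varphi(1),\qquad \|\varphi-\varphi_\varepsilon\|_{L^\infty}\le\varepsilon,$$ and $\varphi_\varepsilon$ is finitely piecewise linear on $[0,1]$.
   Context: A function $f:[0,1]\to\mathbb{R}^2$ is $L$-biLipschitz if $\frac1L|p-q|\le |f(p)-f(q)|\le L|p-q|$ for all $p,q\in[0,1]$ (this forces $L\ge1$). ''Linear'' on an interval means affine; a function is finitely piecewise linear on an interval if the interval can be divided into finitely many subintervals on each of which the function is affine. *)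

(* Defs.v *)
From HB Require Import structures.
From mathcomp Require Import all_boot all_order all_algebra.
From mathcomp Require Import all_classical all_reals all_analysis.

Set Implicit Arguments.
Unset Strict Implicit.
Unset Printing Implicit Defensive.
Import Order.TTheory GRing.Theory Num.Theory.

Local Open Scope ring_scope.

(* The library norm on 'rV[R]_2 is the sup norm, so the Euclidean norm of the
   plane is defined by hand. *)
Definition enorm (R : realType) (v : 'rV[R]_2) : R :=
  Num.sqrt (\sum_(i < 2) v 0 i ^+ 2).

(* A map [0,1] -> R^2 is represented by a total function on R of which only
   the values on [0,1] matter.  The condition 0 < L is implicit in writing 1/L;
   it has to be stated because 0^-1 = 0 here, so that constant maps would
   otherwise be 0-biLipschitz. *)
Definition biLipschitz (R : realType) (L : R) (f : R -> 'rV[R]_2) : Prop :=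
  0 < L /\
  {in `[0, 1] &, forall p q : R,
    L^-1 * `|p - q| <= enorm (f p - f q) <= L * `|p - q|}.

Definition affine_on (R : realType) (f : R -> 'rV[R]_2) (x y : R) : Prop :=
  exists u v : 'rV[R]_2, {in `[x, y], forall t : R, f t = u + t *: v}.

(* The breakpoints a = t_0 < t_1 < ... < t_n = b are the list a :: s. *)
Definition finitely_piecewise_linear (R : realType) (a b : R)
    (f : R -> 'rV[R]_2) : Prop :=
  exists s : seq R, itv_partition a b s /\
    forall i, (i < size s)%N ->
      affine_on f (nth b (a :: s) i) (nth b (a :: s) i.+1).

Definition lebesgue01 (R : realType) : set (measurableTypeR R) -> \bar R :=
  mrestr (@lebesgue_measure R) (measurable_itv `[0, 1]).

Definition Linfty_norm01 (R : realType) (f : R -> 'rV[R]_2) : \bar R :=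
  ('N[@lebesgue01 R]_+oo [EFin \o (@enorm R \o f)])%E.

(* Main.v *)
Require Import Defs.
From HB Require Import structures.
From mathcomp Require Import all_boot all_order all_algebra.
From mathcomp Require Import all_classical all_reals all_analysis.
From mathcomp Require Import ess_sup_inf.
From mathcomp Require Import zify ring lra.

Set Implicit Arguments.
Unset Strict Implicit.
Unset Printing Implicit Defensive.
Import Order.TTheory GRing.Theory Num.Theory.

Local Open Scope ring_scope.

(* Write th = 1/(L+eps) and gap(u,v) = |phi u - phi v| - th (v - u), so that
   gap(u,v) >= (1/L - th)(v - u).  Among all subsets of the grid {k/N} that
   contain 0 and 1, choose one minimizing the sum of gap^2 over consecutive
   points.
   - Merging steps does not decrease the sum, so the gap of any two chosen
     points is at least the gap of each step between them.
   - Refining a step into n grid steps does not decrease it either, so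
     ((1/L - th) n/N)^2 <= n (L/N)^2: each step is at most (L/(1/L - th))^2 / N.
   The polygon through the chosen points is close to phi by the second fact,
   and is L-Lipschitz.  For its lower bound, take x on a chord AB and y on a
   later chord ST; Stewart's theorem writes |x - y|^2 in terms of the six
   distances between A, B, S, T, and the first fact bounds these from below
   enough to give |x - y| >= th (time from x to y). *)

(** * Euclidean distances between points of two segments *)

Section EuclideanNorm.
Context (R : realType).
Implicit Types (u v A B S T : 'rV[R]_2) (k c m : R).

Lemma enorm_ge0 v : 0 <= enorm v.
Proof. exact: sqrtr_ge0. Qed.

Lemma enorm_sqr v : enorm v ^+ 2 = v 0 0 ^+ 2 + v 0 1 ^+ 2.
Proof.
rewrite sqr_sqrtr; last by apply: sumr_ge0 => i _; exact: sqr_ge0.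
by rewrite !big_ord_recl big_ord0 addr0; congr (_ + v _ _ ^+ 2); exact: val_inj.
Qed.

Lemma enormZ k v : enorm (k *: v) = `|k| * enorm v.
Proof.
apply/eqP; rewrite -(@eqrXn2 _ 2) ?mulr_ge0 ?enorm_ge0//.
by rewrite exprMn !enorm_sqr real_normK ?num_real// !mxE; apply/eqP; ring.
Qed.

Lemma enorm_distC u v : enorm (u - v) = enorm (v - u).
Proof. by rewrite -opprB -scaleN1r enormZ normrN1 mul1r. Qed.

Lemma enorm0 : enorm (0 : 'rV[R]_2) = 0.
Proof. by rewrite -(scale0r (0 : 'rV[R]_2)) enormZ normr0 mul0r. Qed.

Lemma enormD u v : enorm (u + v) <= enorm u + enorm v.
Proof.
have uv0 : 0 <= enorm u * enorm v by rewrite mulr_ge0 ?enorm_ge0.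
rewrite -(@ler_pXn2r _ 2) ?nnegrE ?addr_ge0 ?enorm_ge0//.
rewrite sqrrD !enorm_sqr !mxE.
suff : u 0 0 * v 0 0 + u 0 1 * v 0 1 <= enorm u * enorm v by lra.
apply: le_trans (ler_norm _) _.
rewrite -(@ler_pXn2r _ 2) ?nnegrE// real_normK ?num_real// exprMn !enorm_sqr.
have := sqr_ge0 (u 0 0 * v 0 1 - u 0 1 * v 0 0); lra.
Qed.

Lemma enorm_triangle A B S : enorm (A - S) <= enorm (A - B) + enorm (B - S).
Proof. by rewrite -[A - S](subrKA B) enormD. Qed.

(* Stewart's theorem, applied to each of the two segments in turn. *)
Lemma enorm_sqr_chords A B S T c m :
  enorm (A + c *: (B - A) - (S + m *: (T - S))) ^+ 2 =
  c * (1 - m) * enorm (B - S) ^+ 2 + (1 - c) * (1 - m) * enorm (A - S) ^+ 2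
  + c * m * enorm (B - T) ^+ 2 + (1 - c) * m * enorm (A - T) ^+ 2
  - c * (1 - c) * enorm (A - B) ^+ 2 - m * (1 - m) * enorm (S - T) ^+ 2.
Proof. by rewrite !enorm_sqr !mxE; ring. Qed.

End EuclideanNorm.

(** After squaring, the difference of the two sides is a sum of nonnegative products, most of them
    comparing one distance with its lower bound. Here [l] is the fraction of the first segment still
    to be travelled, [m] the fraction of the second already travelled, and [p], [q], [r] are the
    lengths required on the first segment, in between, and on the second. The assumption [m <= l]
    gives the term in [l * (l - m)] its sign. *)
Lemma chords_bound_le (R : realType) (AB BS ST AS BT AT X l m p q r : R) :
  0 <= m -> m <= l -> l <= 1 -> 0 <= p -> p <= AB -> 0 <= q ->
  0 <= r -> r <= ST -> q <= BS -> AB + q <= AS -> ST + q <= BT -> ST + p + q <= AT ->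
  0 <= X ->
  X ^+ 2 = (1 - l) * (1 - m) * BS ^+ 2 + l * (1 - m) * AS ^+ 2
    + (1 - l) * m * BT ^+ 2 + l * m * AT ^+ 2
    - l * (1 - l) * AB ^+ 2 - m * (1 - m) * ST ^+ 2 ->
  l * p + q + m * r <= X.
Proof.
move=> m0 ml l1 p0 pAB q0 r0 rST qBS hAS hBT hAT X0 XE.
have sq (x y : R) : 0 <= x -> x <= y -> 0 <= y ^+ 2 - x ^+ 2.
  by move=> x0 xy; rewrite subr_ge0 ler_pXn2r ?nnegrE// (le_trans x0).
have l0 : 0 <= l by lra.
have l1' : 0 <= 1 - l by lra.
have m1' : 0 <= 1 - m by lra.
have ml' : 0 <= l - m by lra.
have pAB' : 0 <= AB - p by lra.
have rST' : 0 <= ST - r by lra.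
rewrite -(@ler_pXn2r _ 2) ?nnegrE ?addr_ge0 ?mulr_ge0// XE -subr_ge0.
have -> : (1 - l) * (1 - m) * BS ^+ 2 + l * (1 - m) * AS ^+ 2
    + (1 - l) * m * BT ^+ 2 + l * m * AT ^+ 2
    - l * (1 - l) * AB ^+ 2 - m * (1 - m) * ST ^+ 2 - (l * p + q + m * r) ^+ 2 =
  (1 - l) * (1 - m) * (BS ^+ 2 - q ^+ 2)
  + l * (1 - m) * (AS ^+ 2 - (AB + q) ^+ 2)
  + (1 - l) * m * (BT ^+ 2 - (ST + q) ^+ 2)
  + l * m * (AT ^+ 2 - (ST + p + q) ^+ 2)
  + 2 * q * (l * (1 - m) * (AB - p) + m * (ST - r))
  + l * (l - m) * (AB ^+ 2 - p ^+ 2)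
  + m ^+ 2 * (ST ^+ 2 - r ^+ 2) + 2 * (l * m * p * (ST - r)).
  by ring.
have t1 := mulr_ge0 (mulr_ge0 l1' m1') (sq _ _ q0 qBS).
have t2 := mulr_ge0 (mulr_ge0 l0 m1')
  (sq _ _ (addr_ge0 (le_trans p0 pAB) q0) hAS).
have t3 := mulr_ge0 (mulr_ge0 l1' m0)
  (sq _ _ (addr_ge0 (le_trans r0 rST) q0) hBT).
have t4 := mulr_ge0 (mulr_ge0 l0 m0)
  (sq _ _ (addr_ge0 (addr_ge0 (le_trans r0 rST) p0) q0) hAT).
have t5 := mulr_ge0 q0 (mulr_ge0 (mulr_ge0 l0 m1') pAB').
have t6 := mulr_ge0 q0 (mulr_ge0 m0 rST').
have t7 := mulr_ge0 (mulr_ge0 l0 ml') (sq _ _ p0 pAB).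
have t8 := mulr_ge0 (exprn_ge0 2 m0) (sq _ _ r0 rST).
have t9 := mulr_ge0 (mulr_ge0 (mulr_ge0 l0 m0) p0) rST'.
lra.
Qed.

(** Traversing the figure backwards swaps [AB], [p], [l] with [ST], [r], [m], and [AS] with [BT], so
    the case [l < m] reduces to [m <= l]. Each of the two cases uses one of the two lower bounds on
    [AT]. *)
Lemma chords_bound (R : realType) (AB BS ST AS BT AT X l m p q r : R) :
  0 <= m <= 1 -> 0 <= l <= 1 -> 0 <= p <= AB -> 0 <= q -> 0 <= r <= ST ->
  q <= BS -> AB + q <= AS -> ST + q <= BT ->
  AB + q + r <= AT -> ST + p + q <= AT ->
  0 <= X ->
  X ^+ 2 = (1 - l) * (1 - m) * BS ^+ 2 + l * (1 - m) * AS ^+ 2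
    + (1 - l) * m * BT ^+ 2 + l * m * AT ^+ 2
    - l * (1 - l) * AB ^+ 2 - m * (1 - m) * ST ^+ 2 ->
  l * p + q + m * r <= X.
Proof.
move=> /andP[m0 m1] /andP[l0 l1] /andP[p0 pAB] q0 /andP[r0 rST] qBS hAS hBT.
move=> hAT1 hAT2 X0 XE; have [ml|lm] := leP m l.
  by apply: (@chords_bound_le _ AB BS ST AS BT AT).
have -> : l * p + q + m * r = m * r + q + l * p by ring.
apply: (@chords_bound_le _ ST BS AB BT AS AT) => //; [exact: ltW|lra|].
by rewrite XE; ring.
Qed.

(** * Increasing integer paths of minimal weight *)

Lemma path_nth (T : Type) (e : rel T) (x0 x : T) (s : seq T) (i j : nat) :
  transitive e -> path e x s -> (i < j)%N -> (j <= size s)%N ->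
  e (nth x0 (x :: s) i) (nth x0 (x :: s) j).
Proof.
move=> e_trans exs ij js; have es : sorted e (x :: s) := exs.
apply: (sorted_ltn_nth e_trans x0 es); rewrite ?inE ?ltnS//.
exact: leq_trans (ltnW ij) js.
Qed.

Section ShortestPath.
Context (R : realDomainType) (w : nat -> nat -> R).
Hypothesis w_ge0 : forall x y, 0 <= w x y.
Implicit Types (N x y i j l n : nat) (s : seq nat).

Fixpoint path_weight x s : R :=
  if s is y :: s' then w x y + path_weight y s' else 0.

Lemma path_weight_ge0 x s : 0 <= path_weight x s.
Proof. by elim: s x => //= y s IH x; rewrite addr_ge0. Qed.

Lemma path_weight_cat x s1 s2 :
  path_weight x (s1 ++ s2) = path_weight x s1 + path_weight (last x s1) s2.
Proof. by elim: s1 x => [|y s IH] x /=; rewrite ?add0r// IH addrA. Qed.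

Lemma step_le_path_weight x s i : (i < size s)%N ->
  w (nth 0%N (x :: s) i) (nth 0%N s i) <= path_weight x s.
Proof.
elim: s x i => // y s IH x [_|i is_] /=; first by rewrite lerDl path_weight_ge0.
by rewrite (le_trans (IH y i is_))// lerDr.
Qed.

Lemma path_weight_iota x n :
  path_weight x (iota x.+1 n) = \sum_(x <= k < x + n) w k k.+1.
Proof.
elim: n x => [|n IH] x; first by rewrite addn0 big_geq.
by rewrite /= IH big_ltn ?addSnnS// -addSnnS ltn_addr.
Qed.

Lemma last_take x s i : (i <= size s)%N -> last x (take i s) = nth 0%N (x :: s) i.
Proof. by elim: s x i => [|y s IH] x [|i] //= /IH. Qed.

Lemma path_ltn_last x y s : path ltn x s -> y \in x :: s -> (y <= last x s)%N.
Proof.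
elim: s x y => [|z s IH] x y /=; first by rewrite mem_seq1 => _ /eqP->.
move=> /andP[xz zs]; rewrite inE => /predU1P[->|]; last exact: IH.
by rewrite (leq_trans (ltnW xz))// IH// mem_head.
Qed.

Definition path_to N s := path ltn 0%N s && (last 0%N s == N).

Lemma path_to_iota N : path_to N (iota 1 N).
Proof.
apply/andP; split; first exact: (iota_ltn_sorted 0 N.+1).
by rewrite (last_nth 0%N) size_iota -[_ :: _]/(iota 0 N.+1) nth_iota.
Qed.

(** An increasing list is determined by its set of elements, so [s] is the full grid filtered by
    membership in [s]. *)
Lemma path_to_subseq N s : path_to N s -> subseq s (iota 1 N).
Proof.
move=> /andP[ps /eqP ls].
have -> : s = [seq x <- iota 1 N | x \in s].
  apply: (irr_sorted_eq ltn_trans ltnn) => [||x].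
  - exact: path_sorted ps.
  - by apply: sorted_filter; [exact: ltn_trans|exact: iota_ltn_sorted].
  - rewrite mem_filter mem_iota add1n ltnS.
    have [xs|//] := boolP (x \in s).
    have /allP/(_ _ xs)/= -> := order_path_min ltn_trans ps.
    by rewrite -ls path_ltn_last// inE xs orbT.
exact: filter_subseq.
Qed.

(** Subsequences of [iota 1 N] are given by bit masks of length [N]; these form a finite type, so a
    minimum is attained. *)
Lemma minimal_path_exists N : exists2 s, path_to N s &
  forall s', path_to N s' -> path_weight 0%N s <= path_weight 0%N s'.
Proof.
pose f (m : N.-tuple bool) := mask m (iota 1 N).
have path_to_mask s : path_to N s -> exists m, s = f m.
  move=> /path_to_subseq/subseqP[m /eqP + sE]; rewrite size_iota => sm.
  by exists (Tuple sm).
have [m0 m0E] := path_to_mask _ (path_to_iota N).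
have Pm0 : path_to N (f m0) by rewrite -m0E path_to_iota.
have [m Pm mmin] := @arg_minP _ _ _ m0 (fun m => path_to N (f m))
  (fun m => path_weight 0%N (f m)) Pm0.
exists (f m) => // s' /[dup] Ps' /path_to_mask[m' s'E].
by rewrite s'E; apply: mmin; rewrite -s'E.
Qed.

(** Exchange argument: replacing a stretch of a minimal path by another one with the same ends
    cannot lower the weight. The first bound merges a stretch into one step, the second refines one
    step into unit steps. *)
Lemma minimal_path N : exists2 s, path_to N s &
  (forall i l j, (i <= l < j)%N -> (j <= size s)%N ->
    w (nth 0%N (0%N :: s) l) (nth 0%N s l) <=
    w (nth 0%N (0%N :: s) i) (nth 0%N (0%N :: s) j)) /\
  (forall i, (i < size s)%N ->
    w (nth 0%N (0%N :: s) i) (nth 0%N s i) <=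
    \sum_(nth 0%N (0%N :: s) i <= k < nth 0%N s i) w k k.+1).
Proof.
have [s Ps smin] := minimal_path_exists N; exists s => //.
have ps : path ltn 0%N s by case/andP: Ps.
have exchange s1 s2 s3 s2' : s = s1 ++ s2 ++ s3 ->
    path ltn (last 0%N s1) s2' ->
    last (last 0%N s1) s2' = last (last 0%N s1) s2 ->
    path_weight (last 0%N s1) s2 <= path_weight (last 0%N s1) s2'.
  move=> sE ps2' ls2'; move: Ps; rewrite /path_to sE !cat_path !last_cat.
  move=> /andP[/and3P[ps1 _ ps3] /eqP lN].
  have /smin : path_to N (s1 ++ s2' ++ s3).
    by rewrite /path_to !cat_path !last_cat ps1 ps2' ls2' ps3 lN eqxx.
  by rewrite sE !path_weight_cat ls2' lerD2l lerD2r.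
have nth_lt i j : (i < j)%N -> (j <= size s)%N ->
    (nth 0%N (0%N :: s) i < nth 0%N (0%N :: s) j)%N.
  exact: path_nth ltn_trans ps.
have cut i j : (i <= j)%N -> (j <= size s)%N ->
    s = take i s ++ take (j - i) (drop i s) ++ drop j s /\
    last (nth 0%N (0%N :: s) i) (take (j - i) (drop i s)) = nth 0%N (0%N :: s) j.
  move=> ij js; rewrite -last_take ?(leq_trans ij)// -last_cat -takeD subnKC//.
  by rewrite last_take// catA -takeD subnKC// cat_take_drop.
split=> [i l j /andP[il lj] js|i is_].
  have [sE xE] := cut _ _ (leq_trans il (ltnW lj)) js.
  (* Competitor: the single step from vertex [i] to vertex [j]. Since weights are nonnegative, the
     stretch it replaces weighs at least as much as its step [l]. *)
  have := exchange _ _ _ [:: nth 0%N (0%N :: s) j] sE.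
  rewrite last_take; last by lia.
  rewrite xE /= andbT addr0 => /(_ (nth_lt _ _ (leq_ltn_trans il lj) js) erefl).
  apply: le_trans.
  have lsz : (l - i < size (take (j - i) (drop i s)))%N.
    by rewrite size_takel ?size_drop//; lia.
  have := step_le_path_weight (nth 0%N (0%N :: s) i) lsz.
  rewrite nth_take ?nth_drop; last by lia.
  rewrite subnKC//.
  suff -> : nth 0%N (nth 0%N (0%N :: s) i :: take (j - i) (drop i s)) (l - i) =
    nth 0%N (0%N :: s) l by [].
  (* The stretch omits its starting vertex, so [l = i] is the head of the list and larger [l] are
     shifted by one. *)
  have [->|li] := eqVneq l i; first by rewrite subnn.
  have [k lE] : exists k, l = (i + k).+1 by exists (l - i.+1)%N; lia.
  rewrite lE -addnS addKn /= nth_take ?nth_drop ?addnS//; lia.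
have [sE xE] := cut _ _ (leqnSn i) is_.
have xy := nth_lt _ _ (ltnSn i) is_.
set x := nth 0%N (0%N :: s) i in xE xy *; set y := nth 0%N s i in xE xy *.
(* Competitor: all integers from [x + 1] to [y], in place of the single step from [x] to [y]. *)
have := exchange _ _ _ (iota x.+1 (y - x)) sE.
rewrite last_take ?(ltnW is_)// -/x xE path_weight_iota subnKC; last exact: ltnW.
rewrite subSnn; case: (drop i s) (drop_nth 0%N is_) => //= _ d [-> _].
rewrite take0 /= addr0 -/y; apply.
  exact: (iota_ltn_sorted x (y - x).+1).
rewrite (last_nth 0%N) size_iota -[_ :: _]/(iota x (y - x).+1) nth_iota//.
by rewrite subnKC// ltnW.
Qed.

End ShortestPath.

(** * Polygonal interpolation and its biLipschitz bounds *)

Section Polyline.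
Context (R : realType) (f : R -> 'rV[R]_2).
Implicit Types (a b t u v : R) (s : seq R).

Definition chord a b t : 'rV[R]_2 := f a + ((t - a) / (b - a)) *: (f b - f a).

Lemma chordl a b : chord a b a = f a.
Proof. by rewrite /chord subrr mul0r scale0r addr0. Qed.

Lemma chordr a b : a < b -> chord a b b = f b.
Proof.
by move=> ab; rewrite /chord divff ?subr_eq0 ?gt_eqF// scale1r addrC subrK.
Qed.

Lemma enorm_chordB a b u v : a < b -> u <= v ->
  enorm (chord a b u - chord a b v) = (v - u) / (b - a) * enorm (f a - f b).
Proof.
move=> ab uv.
have -> : chord a b u - chord a b v = ((v - u) / (b - a)) *: (f a - f b).
  by apply/rowP => i; rewrite !mxE; field; rewrite subr_eq0 gt_eqF.
by rewrite enormZ ger0_norm// divr_ge0// subr_ge0// ltW.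
Qed.

Lemma chord_affine a b : affine_on (chord a b) a b.
Proof.
exists (f a - (a / (b - a)) *: (f b - f a)), ((b - a)^-1 *: (f b - f a)) => t _.
by apply/rowP => i; rewrite !mxE; ring.
Qed.

(** [s] lists the breakpoints after [a]. Beyond the last breakpoint the map is constant, and at a
    common breakpoint the earlier chord is used. *)
Fixpoint polyline a s t : 'rV[R]_2 :=
  if s is b :: s' then if t <= b then chord a b t else polyline b s' t else f a.

Lemma polyline_start a s : path <%R a s -> polyline a s a = f a.
Proof. by case: s => //= b s /andP[/ltW ab _]; rewrite ab chordl. Qed.

Lemma polyline_chord a s x0 i t : path <%R a s -> (i < size s)%N ->
  nth x0 (a :: s) i <= t <= nth x0 s i ->
  polyline a s t = chord (nth x0 (a :: s) i) (nth x0 s i) t.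
Proof.
elim: s a i => // b s IH a [|i] /andP[ab bs] is_ /=; first by move=> /andP[_ ->].
move=> ti; rewrite -IH//; case: ifP => // tb.
(* A point of a later step that also satisfies [t <= b] must be [b] itself, where consecutive chords
   agree. *)
have bt : b <= t.
  have /andP[+ _] := ti; apply: le_trans.
  case: i is_ {ti} => //= i is_.
  by have /allP/(_ _ (mem_nth x0 (ltnW is_)))/ltW := order_path_min lt_trans bs.
have -> : t = b by apply/eqP; rewrite eq_le tb.
by rewrite chordr// polyline_start.
Qed.

Lemma breakpoint_step a s x0 t : (0 < size s)%N -> a <= t <= last a s ->
  exists2 i, (i < size s)%N & nth x0 (a :: s) i <= t <= nth x0 s i.
Proof.
elim: s a => // b s IH a _ /andP[at_ tl].
have [tb|bt] := leP t b; first by exists 0%N => //=; rewrite at_ tb.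
case: s IH tl => [|c s] IH tl; first by move: tl; rewrite /= leNgt bt.
by have [//||i is_ it] := IH b; [rewrite (ltW bt) tl|exists i.+1].
Qed.

Context (a : R) (s : seq R) (L th : R).
Hypotheses (th0 : 0 <= th) (as_ : path <%R a s).
Local Notation tau i := (nth a (a :: s) i).
Let gap u v : R := enorm (f u - f v) - th * (v - u).
Hypothesis gap_le : forall i l j, (i <= l)%N -> (l < j)%N -> (j <= size s)%N ->
  0 <= gap (tau l) (tau l.+1) <= gap (tau i) (tau j).
Hypothesis lip : forall i j, (i <= j)%N -> (j <= size s)%N ->
  enorm (f (tau i) - f (tau j)) <= L * (tau j - tau i).

Lemma breakpoint_lt i j : (i < j)%N -> (j <= size s)%N -> tau i < tau j.
Proof. exact: path_nth lt_trans as_. Qed.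

Lemma breakpoint_le i j : (i <= j)%N -> (j <= size s)%N -> tau i <= tau j.
Proof.
by rewrite leq_eqVlt => /predU1P[->//|ij] js; rewrite ltW// breakpoint_lt.
Qed.

(** A chord is traversed at constant speed, so the bounds for its two ends pass to all pairs of its
    points. *)
Lemma chord_bilipschitz i u v : (i < size s)%N ->
  tau i <= u -> u <= v -> v <= tau i.+1 ->
  th * (v - u) <= enorm (chord (tau i) (tau i.+1) u - chord (tau i) (tau i.+1) v)
    <= L * (v - u).
Proof.
move=> is_ iu uv vi; have ii := breakpoint_lt (ltnSn i) is_.
rewrite enorm_chordB//.
have /andP[+ _] := gap_le (leqnn i) (ltnSn i) is_; rewrite /gap.
have := lip (leqnSn i) is_.
move: (enorm _) => E EL; rewrite subr_ge0 => thE.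
have d0 : 0 < tau i.+1 - tau i by rewrite subr_gt0.
have -> : (v - u) / (tau i.+1 - tau i) * E = E / (tau i.+1 - tau i) * (v - u).
  by rewrite mulrAC [(v - u) * E]mulrC mulrAC.
by rewrite !ler_wpM2r ?subr_ge0 ?ler_pdivlMr ?ler_pdivrMr.
Qed.

Lemma chords_bilipschitz i j u v : (i < j)%N -> (j < size s)%N ->
  tau i <= u <= tau i.+1 -> tau j <= v <= tau j.+1 ->
  th * (v - u) <= enorm (chord (tau i) (tau i.+1) u - chord (tau j) (tau j.+1) v)
    <= L * (v - u).
Proof.
move=> ij js /andP[iu ui] /andP[jv vj].
have is_ : (i < size s)%N by lia.
have aLb := breakpoint_lt (ltnSn i) is_.
have bLs := breakpoint_le ij (ltnW js).
have sLt := breakpoint_lt (ltnSn j) js.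
(* Upper bound: go through the right end of the first chord and the left end of the second. *)
apply/andP; split; last first.
  apply: (le_trans (enorm_triangle _ (f (tau i.+1)) _)).
  rewrite -{1}(chordr aLb).
  have /andP[_ h1] := chord_bilipschitz is_ iu ui (lexx _).
  apply: (le_trans (lerD h1 (enorm_triangle _ (f (tau j)) _))).
  rewrite -{2}(chordl (tau j) (tau j.+1)).
  have /andP[_ h3] := chord_bilipschitz js (lexx _) jv vj.
  have := lip ij (ltnW js); lra.
have gaps l i' j' : (i' <= l)%N -> (l < j')%N -> (j' <= size s)%N ->
    enorm (f (tau l) - f (tau l.+1)) - th * (tau l.+1 - tau l) <=
    enorm (f (tau i') - f (tau j')) - th * (tau j' - tau i').
  by move=> h1 h2 h3; have /andP[] := gap_le h1 h2 h3.
have gap0 l : (l < size s)%N ->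
    th * (tau l.+1 - tau l) <= enorm (f (tau l) - f (tau l.+1)).
  move=> ls; have /andP[] := gap_le (leqnn l) (ltnSn l) ls.
  by rewrite subr_ge0.
(* For adjacent chords these two points coincide and there is no step between them, hence the
   separate case. *)
have gapBS : th * (tau j - tau i.+1) <= enorm (f (tau i.+1) - f (tau j)).
  have [E|ij'] := eqVneq i.+1 j.
    by rewrite E subrr mulr0 enorm_ge0.
  have h : (i.+1 < j)%N by lia.
  by have /andP[g1 g2] := gap_le (leqnn _) h (ltnW js);
    rewrite -subr_ge0 (le_trans g1).
set A := tau i in iu aLb *; set B := tau i.+1 in ui aLb bLs gapBS *.
set S := tau j in jv bLs sLt gapBS *; set T := tau j.+1 in vj sLt *.
have dAB : B - A != 0 by rewrite subr_eq0 gt_eqF.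
have dST : T - S != 0 by rewrite subr_eq0 gt_eqF.
(* The time from [u] to [v] splits into the rest of the first step, the time between the steps, and
   the elapsed part of the second; this fixes [l], [m], [p], [q], [r] in [chords_bound]. *)
have -> : th * (v - u) = (1 - (u - A) / (B - A)) * (th * (B - A))
    + th * (S - B) + (v - S) / (T - S) * (th * (T - S)).
  by clearbody A B S T; field; apply/andP; split.
apply: (chords_bound (AB := enorm (f A - f B)) (BS := enorm (f B - f S))
  (ST := enorm (f S - f T)) (AS := enorm (f A - f S)) (BT := enorm (f B - f T))
  (AT := enorm (f A - f T))).
- by rewrite divr_ge0 ?ler_pdivrMr ?mul1r ?subr_ge0 ?subr_gt0 ?lerB// ltW.
- have : 0 <= (u - A) / (B - A) <= 1.
    by rewrite divr_ge0 ?ler_pdivrMr ?mul1r ?subr_ge0 ?subr_gt0 ?lerB// ltW.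
  by lra.
- by rewrite mulr_ge0 ?subr_ge0 ?(ltW aLb)//= gap0.
- by rewrite mulr_ge0 ?subr_ge0.
- by rewrite mulr_ge0 ?subr_ge0 ?(ltW sLt)//= gap0.
- exact: gapBS.
(* This rearranges gap(A,B) <= gap(A,S). The next three bounds come likewise from gap(S,T) <=
   gap(B,T), gap(A,B) <= gap(A,T) and gap(S,T) <= gap(A,T). *)
- by have := gaps i i j (leqnn i) ij (ltnW js); rewrite -/A -/B -/S; lra.
- by have := gaps j i.+1 j.+1 ij (ltnSn j) js; rewrite -/B -/S -/T; lra.
- by have := gaps i i j.+1 (leqnn i) (ltnW ij) js; rewrite -/A -/B -/T; lra.
- by have := gaps j i j.+1 (ltnW ij) (ltnSn j) js; rewrite -/A -/S -/T; lra.
- exact: enorm_ge0.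
- by rewrite /chord enorm_sqr_chords; ring.
Qed.

Lemma polyline_bilipschitz u v : a <= u -> u <= v -> v <= last a s ->
  th * (v - u) <= enorm (polyline a s u - polyline a s v) <= L * (v - u).
Proof.
(* With [u = v] set aside, [s] cannot be empty, and the step found for [v] cannot precede the one
   found for [u]. *)
move=> au uv vs; have [->|uNv] := eqVneq u v.
  by rewrite !subrr enorm0 !mulr0 lexx.
have s0 : (0 < size s)%N.
  case: s vs => //= va; move: uNv; rewrite eq_le uv/=.
  by rewrite (le_trans va au).
have [|i is_ /[dup] iu' /andP[iu ui]] := @breakpoint_step a s a u s0.
  by rewrite au (le_trans uv).
have [|j js /[dup] jv' /andP[jv vj]] := @breakpoint_step a s a v s0.
  by rewrite vs (le_trans au).
rewrite (polyline_chord as_ is_ iu') (polyline_chord as_ js jv').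
have [ij|ji|ijE] := ltngtP i j; first exact: chords_bilipschitz.
- have vu : v <= u.
    by rewrite (le_trans vj)// (le_trans _ iu)// (@breakpoint_le j.+1 i)// ltnW.
  by rewrite eq_le uv vu in uNv.
- by rewrite ijE in iu ui *; apply: chord_bilipschitz.
Qed.

End Polyline.

(** * Uniform error, grid estimates and the approximation theorem *)

Lemma Linfty_norm01_le (R : realType) (f : R -> 'rV[R]_2) (M : R) :
  0 <= M -> {in `[0, 1], forall t, enorm (f t) <= M} ->
  (Linfty_norm01 f <= M%:E)%E.
Proof.
move=> M0 fM; rewrite /Linfty_norm01 unlock /Lnorm.
(* When the whole space has measure zero the norm is 0 by convention, and [0 <= M] suffices. *)
case: ifPn => _; last by rewrite lee_fin.
(* The exceptional set is the complement of the unit interval, which is null for the restricted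
   measure. *)
apply/ess_supP; exists (~` `[0, 1])%classic; split.
- by apply: measurableC; exact: (measurable_itv `[(0 : R), 1]).
- rewrite -[LHS]/(lebesgue_measure (~` `[0, 1] `&` `[0, 1])%classic).
  by rewrite setICl measure0.
- move=> t /= ftM t01; apply: ftM; rewrite lee_fin ger0_norm ?enorm_ge0//.
  exact: fM.
Qed.

Lemma sampled_breakpoint (R : realType) (N : nat) (s : seq nat) (i : nat) :
  (i <= size s)%N ->
  nth 0 (0 :: [seq k%:R / N%:R | k <- s]) i =
  (nth 0%N (0%N :: s) i)%:R / N%:R :> R.
Proof.
by case: i => [|i] is_ /=; [rewrite mul0r|rewrite (nth_map 0%N)].
Qed.

(** The left side is quadratic in [n] and the right side linear, so one factor [n] survives
    cancellation. This is why gaps are squared: a linear weight would give no bound on [n]. *)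
Lemma square_step_bound (R : realFieldType) (c L n z : R) :
  0 < c -> 0 < n -> 0 < z -> (c * (n / z)) ^+ 2 <= (L / z) ^+ 2 * n ->
  n <= (L / c) ^+ 2.
Proof.
move=> c0 n0 z0; have cz : 0 < c ^+ 2 * n / z ^+ 2.
  by rewrite divr_gt0 ?mulr_gt0 ?exprn_gt0.
have -> : (c * (n / z)) ^+ 2 = n * (c ^+ 2 * n / z ^+ 2).
  by field; rewrite gt_eqF.
have -> : (L / z) ^+ 2 * n = (L / c) ^+ 2 * (c ^+ 2 * n / z ^+ 2).
  by field; rewrite !gt_eqF.
by rewrite ler_pM2r.
Qed.

Theorem theorem1p2 (R : realType) (L eps : R) (phi : R -> 'rV[R]_2)
    (hphi : biLipschitz L phi) (heps : 0 < eps) :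
  exists phi_eps : R -> 'rV[R]_2,
    [/\ biLipschitz (L + eps) phi_eps,
        phi_eps 0 = phi 0,
        phi_eps 1 = phi 1,
        (Linfty_norm01 (fun t => phi t - phi_eps t)%R <= eps%:E)%E
      & finitely_piecewise_linear 0 1 phi_eps].
Proof.
have [L0 bl] := hphi.
have Le0 : 0 < L + eps by rewrite addr_gt0.
set th := (L + eps)^-1.
have th0 : 0 < th by rewrite invr_gt0.
pose kap := L^-1 - th.
have kap0 : 0 < kap by rewrite subr_gt0 ltf_pV2 ?posrE// ltrDl.
pose K := (L / kap) ^+ 2.
have K0 : 0 < K by rewrite exprn_gt0// divr_gt0.
(* On a step of length at most [K / N], [phi] and the polygon each move by at most [L * K / N] from
   their common left vertex; [N] makes the total less than [eps]. *)
have [N NK] : exists N : nat, 2 * L * K / eps < N%:R.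
  by exists (Num.truncn (2 * L * K / eps)).+1; exact: truncnS_gt.
have N0 : 0 < N%:R :> R by rewrite (le_lt_trans _ NK)// !mulr_ge0// ?invr_ge0 ltW.
pose x (k : nat) : R := k%:R / N%:R.
have xB j k : (j <= k)%N -> x k - x j = (k - j)%:R / N%:R.
  by move=> jk; rewrite /x -mulrBl natrB.
have x01 k : (k <= N)%N -> x k \in `[0, 1].
  by move=> kN; rewrite in_itv /= /x divr_ge0//= ler_pdivrMr// mul1r ler_nat.
pose gap u v := enorm (phi u - phi v) - th * (v - u).
have phiL u v : u \in `[0, 1] -> v \in `[0, 1] -> u <= v ->
    enorm (phi u - phi v) <= L * (v - u).
  by move=> u01 v01 uv; have /andP[_] := bl u v u01 v01;
    rewrite distrC ger0_norm ?subr_ge0.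
have gap_ge u v : u \in `[0, 1] -> v \in `[0, 1] -> u <= v ->
    kap * (v - u) <= gap u v.
  move=> u01 v01 uv; have /andP[+ _] := bl u v u01 v01.
  by rewrite distrC ger0_norm ?subr_ge0// /gap /kap; lra.
have gap_ge0 u v : u \in `[0, 1] -> v \in `[0, 1] -> u <= v -> 0 <= gap u v.
  move=> u01 v01 uv; apply: le_trans (gap_ge u v u01 v01 uv).
  by rewrite mulr_ge0 ?(ltW kap0) ?subr_ge0.
(* The square is nonnegative for every pair of indices, even where the gap is not; on ordered pairs
   in the unit interval gaps are nonnegative, so comparing squares compares gaps. *)
pose w j k := gap (x j) (x k) ^+ 2.
have w0 j k : 0 <= w j k by exact: sqr_ge0.
have [s /andP[sp /eqP sN] [merge split_]] := minimal_path w0 N.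
have sle i : (nth 0%N (0%N :: s) i <= N)%N.
  (* Past the end of the path the default value 0 satisfies the bound too. *)
  have [is_|is_] := ltnP i (size s).+1; last by rewrite nth_default.
  by rewrite -sN path_ltn_last// mem_nth.
have slt i j : (i < j)%N -> (j <= size s)%N ->
    (nth 0%N (0%N :: s) i < nth 0%N (0%N :: s) j)%N.
  exact: path_nth ltn_trans sp.
have xle i j : (i <= j)%N -> x i <= x j.
  by move=> ij; rewrite ler_pM2r ?invr_gt0// ler_nat.
pose xs := [seq x k | k <- s].
have tauE i : (i <= size s)%N -> nth 0 (0 :: xs) i = x (nth 0%N (0%N :: s) i).
  exact: sampled_breakpoint.
have xs_size : size xs = size s by rewrite size_map.
have xs_path : path <%R 0 xs.
  have -> : 0 = x 0%N by rewrite /x mul0r.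
  rewrite path_map; apply: sub_path sp => i j ij.
  by rewrite /= ltr_pM2r ?invr_gt0// ltr_nat.
have xs_last : last 0 xs = 1.
  have -> : 0 = x 0%N by rewrite /x mul0r.
  by rewrite last_map sN /x divff ?gt_eqF.
have step_small i : (i < size s)%N ->
    nth 0 (0 :: xs) i.+1 - nth 0 (0 :: xs) i <= K / N%:R.
  move=> is_; rewrite !tauE ?(ltnW is_)//.
  set j := nth 0%N (0%N :: s) i; set k := nth 0%N (0%N :: s) i.+1.
  have jk : (j < k)%N by exact: slt.
  have := split_ i is_; rewrite -/j -/k.
  (* A unit grid step has gap at most the distance of its images, hence at most [L / N]. *)
  have : \sum_(j <= m < k) w m m.+1 <= \sum_(j <= m < k) (L / N%:R) ^+ 2.
    rewrite [leLHS]big_seq [leRHS]big_seq; apply: ler_sum => m.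
    rewrite mem_index_iota => /andP[jm mk].
    have m01 : x m \in `[0, 1] by exact: x01 (leq_trans (ltnW mk) (sle i.+1)).
    have m1 : x m.+1 \in `[0, 1] by exact: x01 (leq_trans mk (sle i.+1)).
    have mle : x m <= x m.+1 by exact: xle.
    rewrite ler_pXn2r ?nnegrE ?gap_ge0 ?divr_ge0 ?(ltW L0)//.
    rewrite /gap; apply: le_trans (_ : enorm (phi (x m) - phi (x m.+1)) <= _).
      by rewrite gerBl mulr_ge0 ?subr_ge0// ltW.
    by apply: (le_trans (phiL _ _ m01 m1 mle)); rewrite xB// subSnn mul1r.
  rewrite sumr_const_nat -[(L / _) ^+ 2 *+ _]mulr_natr => h1 h2.
  have j01 : x j \in `[0, 1] by exact/x01/sle.
  have k01 : x k \in `[0, 1] by exact/x01/sle.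
  have jkx := xle _ _ (ltnW jk).
  (* The opposite estimate: the gap of the whole step is at least [kap] times its length. *)
  have g1 : (kap * (x k - x j)) ^+ 2 <= w j k.
    by rewrite ler_pXn2r ?nnegrE ?gap_ge0 ?mulr_ge0 ?(ltW kap0) ?subr_ge0 ?gap_ge.
  have := le_trans g1 (le_trans h2 h1).
  rewrite xB ?(ltnW jk)//; set n : R := (k - j)%:R.
  have n0 : 0 < n by rewrite ltr0n subn_gt0.
  rewrite ler_pM2r ?invr_gt0// => h3.
  exact: square_step_bound h3.
have gapP i l j : (i <= l)%N -> (l < j)%N -> (j <= size xs)%N ->
  0 <= gap (nth 0 (0 :: xs) l) (nth 0 (0 :: xs) l.+1)
    <= gap (nth 0 (0 :: xs) i) (nth 0 (0 :: xs) j).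
  rewrite xs_size => il lj js; have ls := leq_trans lj js.
  rewrite !tauE ?(ltnW ls) ?(leq_trans il (ltnW ls))//.
  have g1 : 0 <= gap (x (nth 0%N (0%N :: s) l)) (x (nth 0%N (0%N :: s) l.+1)).
    by apply: gap_ge0; rewrite ?x01// xle// ltnW// slt.
  have g2 : 0 <= gap (x (nth 0%N (0%N :: s) i)) (x (nth 0%N (0%N :: s) j)).
    by apply: gap_ge0; rewrite ?x01// xle// ltnW// slt// (leq_ltn_trans il).
  by rewrite g1 -(@ler_pXn2r _ 2) ?nnegrE//=; apply: merge => //; rewrite il.
have tau01 i : (i <= size xs)%N -> nth 0 (0 :: xs) i \in `[0, 1].
  by rewrite xs_size => is_; rewrite tauE// x01.
have lipP i j : (i <= j)%N -> (j <= size xs)%N ->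
    enorm (phi (nth 0 (0 :: xs) i) - phi (nth 0 (0 :: xs) j)) <=
    L * (nth 0 (0 :: xs) j - nth 0 (0 :: xs) i).
  move=> ij js; apply: phiL; rewrite ?tau01 ?(leq_trans ij)//.
  exact: breakpoint_le xs_path _ _ ij js.
have bil := polyline_bilipschitz (ltW th0) xs_path gapP lipP.
have xs0 : (0 < size xs)%N.
  rewrite lt0n size_eq0; apply/eqP => xsE.
  by move: xs_last; rewrite xsE /= => /esym/eqP; rewrite oner_eq0.
exists (polyline phi 0 xs); split.
- split=> // p q; rewrite !in_itv/= => /andP[p0 p1] /andP[q0 q1].
  wlog pq : p q p0 p1 q0 q1 / p <= q.
    move=> h; have [pq|/ltW qp] := leP p q; first exact: h.
    by rewrite distrC enorm_distC; apply: h.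
  have := bil p q p0 pq; rewrite xs_last => /(_ q1) /andP[b1 b2].
  rewrite distrC ger0_norm ?subr_ge0// b1 (le_trans b2)//.
  (* The upper constant obtained is [L] itself; [eps] is spent only on the lower bound. *)
  by rewrite ler_wpM2r ?subr_ge0// lerDl ltW.
- exact: polyline_start.
(* The point 1 is reached as the right end of the last step, whose index is [(size xs).-1]. *)
- have nx : (size xs).-1.+1 = size xs by rewrite prednK.
  have lx : nth 0 xs (size xs).-1 = 1 by rewrite nth_last xs_last.
  have lt1 := @breakpoint_lt _ 0 xs xs_path _ _ (ltnSn (size xs).-1).
  rewrite nx leqnn in lt1; have := lt1 isT; rewrite -{2}nx /= lx => {}lt1.
  rewrite (@polyline_chord _ _ 0 xs 0 (size xs).-1) ?nx ?lx//; first exact: chordr.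
  by rewrite (ltW lt1) lexx.
- apply: Linfty_norm01_le; first exact: ltW.
  move=> t /[dup] t01; rewrite in_itv/= => /andP[t0 t1].
  have [|i is_ it] := @breakpoint_step _ 0 xs 0 t xs0; first by rewrite t0 xs_last.
  have /andP[it1 it2] := it.
  have a01 := tau01 i (ltnW is_).
  set a := nth 0 (0 :: xs) i in a01 it it1 *.
  (* Both curves are compared with their common value at [a], the left end of the step containing
     [t]. *)
  have ta : t - a <= K / N%:R.
    by apply: le_trans (step_small i _); rewrite -?xs_size//= lerB.
  have pa : polyline phi 0 xs a = phi a.
    rewrite (@polyline_chord _ _ 0 xs 0 i)//; last by rewrite lexx (le_trans it1).
    by rewrite chordl.
  apply: le_trans (enorm_triangle _ (phi a) _) _.
  have /andP[a0 _] : 0 <= a <= 1 by rewrite in_itv in a01.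
  have := bil a t a0 it1; rewrite xs_last pa => /(_ t1)/andP[_ h1].
  have h2 := phiL _ _ a01 t01 it1.
  rewrite enorm_distC; apply: le_trans (lerD h2 h1) _.
  apply: le_trans (_ : 2 * L * (K / N%:R) <= _).
    have -> : L * (t - a) + L * (t - a) = 2 * L * (t - a) by ring.
    by rewrite ler_pM2l// mulr_gt0.
  by rewrite mulrA ler_pdivrMr// [eps * _]mulrC -ler_pdivrMr// ltW.
- exists xs; split; first by split=> //; rewrite xs_last.
  move=> i is_.
  (* The definition of piecewise linearity uses the default 1, the polygon lemmas 0; all indices are
     in range, so the two agree. *)
  have -> : nth 1 (0 :: xs) i = nth 0 (0 :: xs) i.
    by apply: set_nth_default; rewrite /= ltnS ltnW.
  have -> : nth 1 (0 :: xs) i.+1 = nth 0 xs i by apply: set_nth_default.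
  have [u [v uv]] := chord_affine phi (nth 0 (0 :: xs) i) (nth 0 xs i).
  exists u, v => t ti; rewrite -uv//.
  by apply: polyline_chord => //; rewrite in_itv in ti.
Qed.
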